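(* Let $G$ be a connected $k$-regular multigraph of order $n$ (loops and multiple edges allowed) with adjacency matrix $A$. Let $\tau_0,\ldots,\tau_d$ be the distinct eigenvalues of $A$, where $\tau_0=k$. Let $s$ be a positive integer, let $f_0,\ldots,f_s$ be real numbers with $f_0>0$ and $f_i\geq 0$ for each $i\in\{1,\ldots,s\}$, and let $f(x)=\sum_{i=0}^s f_i F_i^{(k)}(x)$. If $f(k)>0$ and $f(\tau_j)\leq 0$ for each $j\in\{1,\ldots,d\}$, then $$n\leq \frac{f(k)}{f_0}.$$
   Context: A multigraph $G=(V,E)$ is finite and undirected, and may have multiple edges and loops. For $u,v\in V$, $m(u,v)$ is the number of edges between $u$ and $v$ if $u\neq v$, and the number of loops on $u$ if $u=v$. The order of $G$ is $n=|V|$. The adjacency matrix of $G$ is the symmetric matrix $A$ indexed by $V$ with $(u,v)$-entry $m(u,v)$ (so each loop contributes $1$ to the diagonal). $G$ is $k$-regular if $\sum_{v\in V} m(u,v)=k$ for each $u\in V$ (so each loop contributes $1$ to the degree). The polynomials $F_i^{(k)}$ (of degree $i$) are defined by $F_0^{(k)}(x)=1$, $F_1^{(k)}(x)=x$, $F_2^{(k)}(x)=x^2-k$, and $F_i^{(k)}(x)=xF_{i-1}^{(k)}(x)-(k-1)F_{i-2}^{(k)}(x)$ for $i\geq 3$. *)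

(* Defs.v *)
From HB Require Import structures.
From mathcomp Require Import all_boot all_order all_algebra.
From mathcomp Require Import reals.

Set Implicit Arguments.
Unset Strict Implicit.
Unset Printing Implicit Defensive.

Import Order.TTheory GRing.Theory Num.Theory.
Local Open Scope ring_scope.

(* An undirected edge is incident to a set of one (loop) or two vertices;     *)
(* distinct edges may have the same set of ends.                              *)
Record multigraph := Multigraph {
  vertex : finType;
  edge : finType;
  ends : edge -> {set vertex};
  card_ends : forall e, (0 < #|ends e| <= 2)%N
}.

Section Multigraph.

Variable G : multigraph.
Implicit Types u v : vertex G.

Definition graph_order : nat := #|vertex G|.

(* For u = v, [set u; u] is [set u], so mult u u counts the loops on u once.  *)
Definition mult u v : nat := #|[set e : edge G | ends e == [set u; v]]|.

Definition adjacent : rel (vertex G) := [rel u v | (0 < mult u v)%N].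

Definition connected_graph : Prop :=
  (0 < graph_order)%N /\ forall u v, connect adjacent u v.

Definition regular_graph (k : nat) : Prop :=
  forall u, (\sum_v mult u v)%N = k.

Definition adjmx (R : nzRingType) : 'M[R]_graph_order :=
  \matrix_(i, j) (mult (enum_val i) (enum_val j))%:R.

End Multigraph.

(* Fpoly R k i is $F_i^{(k)}$; k - 1 is computed in R, not truncated in nat.  *)
Fixpoint Fpoly (R : nzRingType) (k i : nat) {struct i} : {poly R} :=
  match i with
  | 0 => 1
  | 1 => 'X
  | 2 => 'X^2 - k%:R%:P
  | (i2.+1 as i1).+1 => 'X * Fpoly R k i1 - (k%:R - 1) *: Fpoly R k i2
  end.

(* Main.v *)
Require Import Defs.
From HB Require Import structures.
From mathcomp Require Import all_boot all_order all_algebra.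
From mathcomp Require Import reals complex.

Set Implicit Arguments.
Unset Strict Implicit.
Unset Printing Implicit Defensive.

Import Order.TTheory GRing.Theory Num.Theory.
Local Open Scope ring_scope.

(** Let a dart be an edge together with an orientation (a loop gives one dart,
    its own reverse), let [S] and [T] be the vertex-by-dart and dart-by-vertex
    incidence matrices of tails and heads, and [J] the dart reversal.  Then
    [A = S T], and [B = T S - J] has entries 0 and 1: it records which darts may
    follow each other in a non-backtracking walk.  The relations [S J = T^T],
    [T^T J = S] and [T^T T = k] give [F_i(A) = S B^(i-1) T] for [i >= 1], so these
    matrices have nonnegative entries and [tr f(A) >= n f_0].  On the other hand
    [A] is diagonalizable over the reals and connectedness makes [k] a simple
    eigenvalue, so [tr f(A)], the sum of [f] over the spectrum, is at most
    [f(k)]. *)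

(** * Spectral theory of real symmetric matrices *)

(** Over [R[i]] the matrix is Hermitian, so the spectral theorem gives a real diagonal form; real
    matrices similar over [R[i]] are already similar over [R]. *)
Lemma real_symmetric_diagonalizable (R : rcfType) n (A : 'M[R]_n) :
  A^T = A ->
  exists2 P : 'M[R]_n, P \in unitmx &
    exists d : 'rV[R]_n, P *m A = diag_mx d *m P.
Proof.
move=> symA; pose toC : R -> R[i] := real_complex R.
have realC m p (M : 'M[R]_(m, p)) : map_mx toC M \is a mxOver Num.real.
  by apply/mxOverP => i j; rewrite mxE; apply/complex_realP; exists (M i j).
have liftR m p (M : 'M[R[i]]_(m, p)) :
    M \is a mxOver Num.real -> M = map_mx toC (map_mx (@complex.Re R) M).
  move=> /mxOverP MR; apply/matrixP => i j.
  by rewrite !mxE; apply/esym/RRe_real/MR.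
set AC := map_mx toC A.
have hermAC : AC \is hermsymmx.
  apply: realsym_hermsym; last exact: realC.
  by apply/is_hermitianmxP; rewrite expr0 scale1r map_mx_id // map_trmx symA.
have /orthomx_spectralP := hermitian_normalmx hermAC.
set P := spectralmx AC; set D := spectral_diag AC => ACE.
have DR : D \is a mxOver Num.real by exact: hermitian_spectral_diag_real.
have diagDR : diag_mx D \is a mxOver Num.real by rewrite mxOver_diag ?rpred0.
have [|Q /andP[QR uQ]] := @real_similar _ _ AC (diag_mx D) _ (realC _ _ _) diagDR.
  exists P; first exact: spectral_unit.
  apply/similarP; rewrite ?spectral_unit // ACE !mulmxA.
  by rewrite mulmxV ?mul1mx ?spectral_unit.
move=> /(similarP uQ) QE; exists (map_mx (@complex.Re R) Q).
  by rewrite -(map_unitmx (real_complex R)) -liftR.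
exists (map_mx (@complex.Re R) D).
apply: (@map_mx_inj _ _ (real_complex R)).
by rewrite !map_mxM map_diag_mx /= -!liftR.
Qed.

(** The trace is the sum of [f] over a diagonal form of [A]. Simplicity lets [k] occur there at most
    once, and every other term is nonpositive; [0 <= f.[k]] covers the case where [k] does not
    occur. *)
Lemma trace_horner_le (R : rcfType) n (A : 'M[R]_n.+1) (k : R) (f : {poly R}) :
  A^T = A ->
  (forall v : 'rV_n.+1, v *m A = k *: v -> exists a, v = const_mx a) ->
  0 <= f.[k] ->
  (forall x, eigenvalue A x -> x != k -> f.[x] <= 0) ->
  \tr (horner_mx A f) <= f.[k].
Proof.
move=> symA simple_k fk_ge0 f_le0.
have [P uP [d PA]] := real_symmetric_diagonalizable symA.
have rowPA i : row i P *m A = d 0 i *: row i P.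
  by rewrite -row_mul PA row_mul row_diag_mx -scalemxAl -rowE.
have rowP_neq0 i : row i P != 0.
  apply/eqP => Pi0; have := mulmxK uP (delta_mx 0 i : 'rV_n.+1).
  rewrite -rowE Pi0 mul0mx => /matrixP/(_ 0 i)/eqP.
  by rewrite !mxE !eqxx eq_sym oner_eq0.
have d_inj i j : d 0 i = k -> d 0 j = k -> i = j.
  move=> di dj; apply/eqP/negPn/negP => neq_ij.
  have [a Pi] : exists a, row i P = const_mx a.
    by apply: simple_k; rewrite rowPA di.
  have [b Pj] : exists b, row j P = const_mx b.
    by apply: simple_k; rewrite rowPA dj.
  (* The combination [b *: row i P - a *: row j P] vanishes, so invertibility of [P] forces [b = 0],
     making row [j] zero. *)
  have := mulmxK uP (b *: delta_mx 0 i - a *: delta_mx 0 j : 'rV_n.+1).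
  rewrite mulmxBl -!scalemxAl -!rowE Pi Pj.
  have -> : b *: const_mx a - a *: const_mx b = 0 :> 'rV_n.+1.
    by apply/rowP => l; rewrite !mxE mulrC subrr.
  rewrite mul0mx => /matrixP/(_ 0 i).
  rewrite !mxE !eqxx (negPf neq_ij) mulr0 subr0 mulr1 => b0.
  by have := rowP_neq0 j; rewrite Pj -b0 => /eqP[]; apply/rowP => l; rewrite !mxE.
have -> : A = invmx P *m diag_mx d *m P by rewrite -mulmxA -PA mulKmx.
rewrite horner_mx_uconjC // mxtrace_mulC mulmxA mulmxV // mul1mx.
rewrite horner_mx_diag mxtrace_diag.
under eq_bigr do rewrite mxE.
have df_le0 i : d 0 i != k -> f.[d 0 i] <= 0.
  by apply: f_le0; apply/eigenvalueP; exists (row i P).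
have [/existsP[i /eqP di]|/existsPn no_k] := boolP [exists i, d 0 i == k].
  rewrite (bigD1 i) //= di gerDl; apply: sumr_le0 => j neq_ji; apply: df_le0.
  by apply: contra_neq neq_ji => dj; apply: d_inj.
by apply: le_trans fk_ge0; apply: sumr_le0 => i _; apply/df_le0/no_k.
Qed.

(** * Polynomials of the adjacency matrix as non-backtracking products *)

Section NonbacktrackingFactorization.
Variables (R : realDomainType) (n m k : nat).
Variables (S : 'M[R]_(n.+1, m)) (T : 'M[R]_(m, n.+1)) (J : 'M[R]_m).
Hypotheses (SJ : S *m J = T^T) (TJ : T^T *m J = S) (TT : T^T *m T = k%:R%:M).

(** With [B = T S - J], the recurrence comes from [S J B = T^T T S - T^T J = (k - 1) S]. For [F_2]
    the subtracted term is instead [S J T = T^T T = k], whence its exceptional form. *)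
Lemma horner_Fpoly_nonbacktracking i :
  horner_mx (S *m T) (Fpoly R k i.+1) = S *m iter i (mulmx (T *m S - J)) T.
Proof.
elim/ltn_ind: i => -[|[|i]] IH.
- by rewrite horner_mx_X.
- rewrite rmorphB /= rmorphXn /= horner_mx_X horner_mx_C expr2.
  by rewrite -mulmxE mulmxBl mulmxBr !mulmxA SJ TT.
have IHi1 := IH i.+1 (ltnSn _); have IHi := IH i (leqnSn _).
rewrite -[Fpoly R k i.+3]/('X * Fpoly R k i.+2 - (k%:R - 1) *: Fpoly R k i.+1).
move: (Fpoly R k i.+2) (Fpoly R k i.+1) IHi1 IHi => p q IHp IHq.
rewrite rmorphB rmorphM /= linearZ /= horner_mx_X IHp IHq /=.
set W := iter _ _ _.
rewrite [in RHS]mulmxBl mulmxBr !mulmxA SJ; congr (_ - _).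
  by rewrite -mulmxE !mulmxA.
rewrite -[RHS]mulmxA mulmxBl mulmxBr !mulmxA TT TJ.
by rewrite mul_scalar_mx -scalemxAl scalerBl scale1r.
Qed.

Lemma horner_Fpoly_ge0 i u v :
  (forall u d, 0 <= S u d) -> (forall d v, 0 <= T d v) ->
  (forall d d', 0 <= (T *m S - J) d d') ->
  0 <= horner_mx (S *m T) (Fpoly R k i.+1) u v.
Proof.
move=> S_ge0 T_ge0 B_ge0; rewrite horner_Fpoly_nonbacktracking mxE.
apply: sumr_ge0 => d _; apply: mulr_ge0 => //.
elim: i d v => [|i IH] d w //=; rewrite mxE; apply: sumr_ge0 => d' _.
exact: mulr_ge0.
Qed.

End NonbacktrackingFactorization.

(* Twice the quadratic form of [k - A] at [v] is the Dirichlet sum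
   [\sum_(i, j) A i j * (v i - v j)^2]. *)
Lemma eigenvector_constant_across_edges (R : realDomainType) n
    (A : 'M[R]_n) (k : R) (v : 'rV[R]_n) :
  A^T = A -> (forall i j, 0 <= A i j) -> (forall i, \sum_j A i j = k) ->
  v *m A = k *: v ->
  forall i j, A i j != 0 -> v 0 i = v 0 j.
Proof.
move=> symA A_ge0 rowA vA.
have symAE i j : A j i = A i j by rewrite -[in LHS]symA mxE.
have vAE i : \sum_j A i j * v 0 j = k * v 0 i.
  have /matrixP/(_ 0 i) := vA; rewrite !mxE => <-.
  by apply: eq_bigr => j _; rewrite mulrC symAE.
pose N := \sum_i v 0 i ^+ 2.
(* Expanding the square in the Dirichlet sum leaves three double sums, each equal to [k * N], with
   coefficients 1, 1 and -2. *)
have row_sum : \sum_i \sum_j A i j * v 0 i ^+ 2 = k * N.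
  by rewrite mulr_sumr; apply: eq_bigr => i _; rewrite -mulr_suml rowA.
have col_sum : \sum_i \sum_j A i j * v 0 j ^+ 2 = k * N.
  rewrite exchange_big -row_sum; apply: eq_bigr => i _.
  by apply: eq_bigr => j _; rewrite symAE.
have cross_sum : \sum_i \sum_j A i j * (v 0 i * v 0 j) = k * N.
  rewrite mulr_sumr; apply: eq_bigr => i _.
  rewrite expr2 mulrA -vAE mulr_suml; apply: eq_bigr => j _.
  by rewrite mulrAC mulrA.
have dirichlet : \sum_i \sum_j A i j * (v 0 i - v 0 j) ^+ 2 = 0.
  transitivity (k * N + k * N - (k * N + k * N)); last by rewrite subrr.
  rewrite -{1}row_sum -{1}col_sum -cross_sum -!big_split -sumrB /=.
  apply: eq_bigr => i _; rewrite -!big_split -sumrB /=; apply: eq_bigr => j _.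
  by rewrite sqrrB mulrDr mulrBr mulr2n mulrDr addrAC.
have term_ge0 i j : 0 <= A i j * (v 0 i - v 0 j) ^+ 2.
  by rewrite mulr_ge0 ?sqr_ge0.
move=> i j Aij.
have row_ge0 l : true -> 0 <= \sum_j A l j * (v 0 l - v 0 j) ^+ 2.
  by move=> _; apply: sumr_ge0.
have /(_ i isT) := psumr_eq0P row_ge0 dirichlet.
move=> /(psumr_eq0P (fun j _ => term_ge0 i j))/(_ j isT)/eqP.
by rewrite mulf_eq0 (negPf Aij) sqrf_eq0 subr_eq0 => /eqP.
Qed.

Lemma sum_enum_val (R : nmodType) (I : finType) (F : I -> R) :
  \sum_(i < #|I|) F (enum_val i) = \sum_x F x.
Proof. by rewrite -big_enum_val. Qed.

(** * Incidence matrices of darts *)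

Section Darts.
Variables (R : realDomainType) (G : multigraph).
Local Notation V := (vertex G).
Local Notation D := (V * V * edge G)%type.
Implicit Types (d : D) (u v : V).

(* The triple (u, v, e) stands for [e] traversed from [u] to [v]; the triples
   that are not darts index zero rows and columns of the matrices below. *)
Definition is_dart d := ends d.2 == [set d.1.1; d.1.2].
Definition rev_dart d : D := (d.1.2, d.1.1, d.2).

Lemma rev_dartK : involutive rev_dart.
Proof. by case=> -[]. Qed.

Lemma is_rev_dart d : is_dart (rev_dart d) = is_dart d.
Proof. by rewrite /is_dart /= setUC. Qed.

(** The end selector [p] is a parameter so that one computation with [revmx] serves both tails and
    heads. *)
Definition dart_endmx (p : D -> V) : 'M[R]_(graph_order G, #|{: D}|) :=
  \matrix_(i, d) (is_dart (enum_val d) && (p (enum_val d) == enum_val i))%:R.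
Definition tailmx := dart_endmx (fun d => d.1.1).
Definition headmx := (dart_endmx (fun d => d.1.2))^T.
Definition revmx : 'M[R]_#|{: D}| :=
  \matrix_(d, d')
    (is_dart (enum_val d) && (enum_val d' == rev_dart (enum_val d)))%:R.

Lemma dart_endmx_rev p : dart_endmx p *m revmx = dart_endmx (p \o rev_dart).
Proof.
apply/matrixP => i d'; rewrite !mxE.
under eq_bigr do rewrite !mxE.
pose F d : R := (is_dart d && (p d == enum_val i))%:R
  * (is_dart d && (enum_val d' == rev_dart d))%:R.
rewrite (sum_enum_val F) (bigD1 (rev_dart (enum_val d'))) //= big1 => [|d].
  by rewrite /F is_rev_dart rev_dartK eqxx andbT -natrM mulnb addr0 andbAC andbb.
rewrite /F [_ == rev_dart d]eq_sym (can2_eq rev_dartK rev_dartK).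
by move=> /negPf->; rewrite andbF mulr0.
Qed.

Lemma tail_rev : tailmx *m revmx = headmx^T.
Proof. by rewrite /headmx trmxK; exact: dart_endmx_rev. Qed.

Lemma head_rev : headmx^T *m revmx = tailmx.
Proof. by rewrite /headmx trmxK; exact: dart_endmx_rev. Qed.

(** Darts from [u] to [v] are the triples [(u, v, e)] with [e] counted by [mult u v]; a loop gives a
    single dart, matching its contribution 1 to the diagonal. *)
Lemma tail_head : tailmx *m headmx = adjmx G R.
Proof.
apply/matrixP => i j; rewrite !mxE; set u := enum_val i; set v := enum_val j.
under eq_bigr do rewrite !mxE -natrM mulnb.
rewrite (sum_enum_val (fun d => ((is_dart d && (d.1.1 == u))
  && (is_dart d && (d.1.2 == v)))%:R)) -natr_sum -[in LHS]big_mkcond sum1_card.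
have dart_inj : injective (fun e => (u, v, e) : D) by move=> e e' [].
rewrite /mult -(card_imset _ dart_inj); congr (_%:R); apply: eq_card => d.
apply/idP/imsetP => [/andP[/andP[de /eqP du] /andP[_ /eqP dv]]|[e]].
  exists d.2; last by rewrite -du -dv; case: (d) => -[].
  by rewrite inE -du -dv.
by rewrite inE => ee ->; rewrite unfold_in /is_dart /= ee !eqxx.
Qed.

(** A dart has only one head, so off-diagonal entries vanish; a diagonal entry counts the darts into
    a vertex, which is its degree. *)
Lemma head_head k : regular_graph G k -> headmx^T *m headmx = k%:R%:M.
Proof.
move=> regG; apply/matrixP => i j; rewrite !mxE.
have [<-|neq_ij] := eqVneq i j; last first.
  rewrite big1 // => d _; rewrite !mxE -natrM mulnb.
  have [->|_] := eqVneq (enum_val d).1.2 (enum_val i); last by rewrite andbF.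
  by rewrite (inj_eq enum_val_inj) (negPf neq_ij) !andbF.
have <- : \sum_l adjmx G R l i = k%:R.
  rewrite -(regG (enum_val i)) natr_sum -[RHS]sum_enum_val.
  by apply: eq_bigr => l _; rewrite mxE /mult setUC.
(* After exchanging the sums, each dart into the vertex is counted once, at its unique tail. *)
rewrite mulr1n -tail_head; under [RHS]eq_bigr do rewrite mxE.
rewrite exchange_big /=; apply: eq_bigr => d _; rewrite -mulr_suml !mxE.
case: (boolP (is_dart _ && _)) => [/andP[de _]|_]; last by rewrite !mulr0.
rewrite !mulr1 (bigD1 (enum_rank (enum_val d).1.1)) //= big1 => [|l].
  by rewrite mxE de enum_rankK eqxx addr0.
by rewrite mxE -(inj_eq enum_val_inj) enum_rankK eq_sym => /negPf->; rewrite andbF.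
Qed.

Lemma tailmx_ge0 i x : 0 <= tailmx i x.
Proof. by rewrite mxE ler0n. Qed.

Lemma headmx_ge0 x i : 0 <= headmx x i.
Proof. by rewrite !mxE ler0n. Qed.

(** Where [revmx] has entry 1, [y] is the reverse of [x], so the tail of [y] is the head of [x] and
    that vertex contributes a compensating 1 to the product. *)
Lemma nonbacktrackingmx_ge0 x y : 0 <= (headmx *m tailmx - revmx) x y.
Proof.
have term_ge0 i : 0 <= headmx x i * tailmx i y.
  by rewrite mulr_ge0 ?headmx_ge0 ?tailmx_ge0.
rewrite !mxE; case: (boolP (is_dart _ && _)) => [/andP[dx /eqP yE]|_]; last first.
  by rewrite subr0; apply: sumr_ge0.
rewrite subr_ge0 (bigD1 (enum_rank (enum_val x).1.2)) //=.
rewrite !mxE enum_rankK yE is_rev_dart dx !eqxx mulr1 lerDl.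
exact: sumr_ge0.
Qed.

End Darts.

(** * Simplicity of the eigenvalue k and the trace bound *)

(** Equality of the entries at adjacent vertices propagates along paths, and connectedness joins
    every vertex to a fixed base vertex. *)
Lemma connected_regular_simple (R : realDomainType) (G : multigraph) k
    (v : 'rV[R]_(graph_order G)) :
  connected_graph G -> regular_graph G k ->
  v *m adjmx G R = k%:R *: v -> exists a, v = const_mx a.
Proof.
move=> [G_gt0 conn] regG vA.
have edgeP := eigenvector_constant_across_edges _ _ _ vA.
have v_adj x y : adjacent x y -> v 0 (enum_rank x) = v 0 (enum_rank y).
  move=> xy; apply: edgeP => [|i j|i|]; last first.
  - by rewrite mxE !enum_rankK pnatr_eq0 -lt0n.
  - under eq_bigr do rewrite mxE.
    by rewrite (sum_enum_val (fun y => (mult (enum_val i) y)%:R)) -natr_sum regG.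
  - by rewrite mxE ler0n.
  - by apply/matrixP => i j; rewrite !mxE /mult setUC.
exists (v 0 (Ordinal G_gt0)); apply/rowP => j; rewrite mxE.
rewrite -(enum_valK j) -(enum_valK (Ordinal G_gt0)).
have /connectP[p] := conn (enum_val j) (enum_val (Ordinal G_gt0)).
elim: p (enum_val j) => [|y p IH] x /= => [_ ->//|/andP[xy yp] last_p].
by rewrite (v_adj x y) // IH.
Qed.

(** In the trace of [f] at [S T], the constant term gives [n * c ord0] and the others are
    nonnegative. The size is a variable so that case analysis yields the form [n.+1] used by
    [horner_mx]. *)
Lemma trace_bound_order (R : rcfType) n m k (S : 'M[R]_(n, m))
    (T : 'M[R]_(m, n)) (J : 'M[R]_m) s (c : 'I_s.+1 -> R) :
  S *m J = T^T -> T^T *m J = S -> T^T *m T = k%:R%:M ->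
  (forall i x, 0 <= S i x) -> (forall x i, 0 <= T x i) ->
  (forall x y, 0 <= (T *m S - J) x y) ->
  (S *m T)^T = S *m T ->
  (forall v : 'rV_n, v *m (S *m T) = k%:R *: v -> exists a, v = const_mx a) ->
  0 < c ord0 -> (forall i : 'I_s.+1, (0 < i)%N -> 0 <= c i) ->
  let f : {poly R} := \sum_(i < s.+1) c i *: Fpoly R k i in
  0 <= f.[k%:R] ->
  (forall x, eigenvalue (S *m T) x -> x != k%:R -> f.[x] <= 0) ->
  n%:R <= f.[k%:R] / c ord0.
Proof.
case: n S T => [|n] S T SJ TJ TT S_ge0 T_ge0 B_ge0 symA simple_k c0 c_ge0 f fk.
  by move=> _; rewrite divr_ge0 // ltW.
move=> f_le0.
rewrite ler_pdivlMr //; apply: le_trans (trace_horner_le symA simple_k fk f_le0).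
rewrite /f linear_sum linear_sum big_ord_recl /=.
rewrite linearZ linearZ /= rmorph1 mxtrace1 mulrC lerDl.
apply: sumr_ge0 => i _; rewrite linearZ linearZ /=.
apply: mulr_ge0; first exact: c_ge0.
by apply: sumr_ge0 => u _; exact: horner_Fpoly_ge0 SJ TJ TT _ _ _ _ _ _.
Qed.

Theorem theorem2p2 (R : realType) (G : multigraph) (k : nat)
    (G_connected : connected_graph G) (G_regular : regular_graph G k)
    (d : nat) (tau : 'I_d.+1 -> R) (tau_inj : injective tau)
    (tau_eigenvalues :
       forall x : R, eigenvalue (adjmx G R) x <-> exists j, x = tau j)
    (tau0 : tau ord0 = k%:R)
    (s : nat) (s_gt0 : (0 < s)%N) (c : 'I_s.+1 -> R)
    (c0_gt0 : 0 < c ord0)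
    (c_ge0 : forall i : 'I_s.+1, (0 < i)%N -> 0 <= c i) :
  let f : {poly R} := \sum_(i < s.+1) c i *: Fpoly R k i in
  0 < f.[k%:R] ->
  (forall j : 'I_d.+1, (0 < j)%N -> f.[tau j] <= 0) ->
  (graph_order G)%:R <= f.[k%:R] / c ord0.
Proof.
move=> f fk_gt0 f_le0.
have AE := tail_head R G.
apply: (trace_bound_order (tail_rev R G) (head_rev R G) (head_head R G_regular)) => //.
- exact: tailmx_ge0.
- exact: headmx_ge0.
- exact: nonbacktrackingmx_ge0.
- by rewrite AE; apply/matrixP => i j; rewrite !mxE /mult setUC.
- by move=> v; rewrite AE; exact: connected_regular_simple.
- exact: ltW.
(* Since [tau ord0] is [k], an eigenvalue other than [k] has a positive index. *)
move=> x; rewrite AE => /tau_eigenvalues[j ->] tau_neq.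
by apply: f_le0; rewrite lt0n; apply: contra_neq tau_neq => j0;
  rewrite -tau0; congr tau; apply: val_inj.
Qed.
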